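(* Let $d\ge 2$ and $c>0$. There exists a constant $C>0$, depending only on $d$ and $c$, such that the following holds for every odd prime power $q$ and every set $E\subset\mathbb{F}_q^d$ with $\#E\ge c\,q^{d/2}$. Put $$\mathcal{M}(q)=\frac{q^{3d+1}}{(\#E)^4}\sum_{\{(m,m')\in\mathbb{F}_q^d\times\mathbb{F}_q^d:\ |m|^2=|m'|^2\}}|\widehat{E}(m)|^2\,|\widehat{E}(m')|^2 .$$ Then $$\#\Delta(E)\ \ge\ C\,\min\left\{q,\ \frac{q}{\mathcal{M}(q)}\right\}.$$
   Context: $\mathbb{F}_q$ is the finite field with $q$ elements and $\mathbb{F}_q^d$ is the $d$-dimensional vector space over it. For $x\in\mathbb{F}_q^d$, $|x|^2=x_1^2+\dots+x_d^2\in\mathbb{F}_q$, and $\Delta(E)=\{|x-y|^2: x,y\in E\}\subset\mathbb{F}_q$. Fix a nontrivial additive character $\chi$ of $\mathbb{F}_q$ (for $q$ prime, $\chi(t)=e^{2\pi i t/q}$). For $F:\mathbb{F}_q^d\to\mathbb{C}$, the Fourier transform is $\widehat{F}(m)=q^{-d}\sum_{x\in\mathbb{F}_q^d}\chi(-x\cdot m)F(x)$, $m\in\mathbb{F}_q^d$, where $x\cdot m=\sum_j x_jm_j$. $E$ also denotes the characteristic function of the set $E$, so $\widehat{E}(m)=q^{-d}\sum_{x\in E}\chi(-x\cdot m)$. *)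

(* Defs.v *)
From HB Require Import structures.
From mathcomp Require Import all_boot all_order all_algebra.
From mathcomp Require Import complex.
From mathcomp Require Import reals exp.

Set Implicit Arguments.
Unset Strict Implicit.
Unset Printing Implicit Defensive.

Import Order.TTheory GRing.Theory Num.Theory.

Local Open Scope ring_scope.
Local Open Scope complex_scope.

Section FiniteFieldSpace.
Variables (F : finFieldType) (d : nat).
Implicit Types (x y : 'rV[F]_d) (E : {set 'rV[F]_d}).

Definition dotv x y : F := \sum_(j < d) x 0 j * y 0 j.

(* The F-valued |x|^2; over a finite field it is not a norm. *)
Definition sqlen x : F := \sum_(j < d) x 0 j ^+ 2.

Definition distance_set E : {set F} := [set sqlen (x - y) | x in E, y in E].

End FiniteFieldSpace.

Section Fourier.
Variables (R : realType) (F : finFieldType) (d : nat).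
Implicit Types (chi : F -> R[i]) (E : {set 'rV[F]_d}).

(* A homomorphism from (F, +) to the multiplicative group of R[i]: the values
   are nonzero because chi x * chi (- x) = chi 0 = 1. *)
Definition additive_character chi : Prop :=
  chi 0 = 1 /\ (forall x y, chi (x + y) = chi x * chi y).

Definition nontrivial_character chi : Prop := exists x, chi x <> 1.

Definition fourier chi (f : 'rV[F]_d -> R[i]) (m : 'rV[F]_d) : R[i] :=
  (#|F|%:R ^+ d)^-1 * \sum_(x : 'rV[F]_d) chi (- dotv x m) * f x.

Definition char_fun E : 'rV[F]_d -> R[i] := fun x => (x \in E)%:R.

(* normc is the R-valued modulus, whereas `|z| on R[i] is R[i]-valued. *)
Definition Mq chi E : R :=
  #|F|%:R ^+ (3 * d + 1) / #|E|%:R ^+ 4 *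
  \sum_(p : 'rV[F]_d * 'rV[F]_d | sqlen p.1 == sqlen p.2)
     ComplexField.Normc.normc (fourier chi (char_fun E) p.1) ^+ 2 *
     ComplexField.Normc.normc (fourier chi (char_fun E) p.2) ^+ 2.

End Fourier.

(* Main.v *)
Require Import Defs.
From HB Require Import structures.
From mathcomp Require Import all_boot all_order all_algebra.
From mathcomp Require Import ring lra.
From mathcomp Require Import complex.
From mathcomp Require Import reals exp.

(** Write N = #E, q = #F, let nu(t) be the number of pairs of points of E at
    distance t, and S the sum of |E^(m)|^2 |E^(m')|^2 over |m|^2 = |m'|^2.  By
    Cauchy-Schwarz N^4 = (sum nu)^2 <= #Delta(E) * sum nu^2
    ([card_dist_energy]), so it is enough to bound the distance energy
    sum nu^2 from above by N^4 (1 + M(q)) / q; then #Delta(E) >= q / (1 + M(q)),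
    which is at least half of min(q, q / M(q)).

    The energy is the L^2 norm of f(s) = sum over x, y in E of
    chi (s |x - y|^2): Plancherel on F gives q sum nu^2 = sum_s |f(s)|^2
    ([sum_dist_sum]), and s = 0 contributes N^4.  In the same way, with
    g(u) = sum_m chi (u |m|^2) |e(m)|^2 and e(m) = q^d E^(m), Plancherel turns
    sum_u |g(u)|^2 into q^(4d+1) S ([level_plancherel]).  These two
    functions are dual to each other: expanding |e(m)|^2 and completing the
    square in m gives g(u) = H(u) f(-1/(4u)) for u != 0 ([dual_dist_sum]), where
    the Gauss sum H(u) has modulus q^(d/2) ([norm_gauss_sum]).  As
    u |-> -1/(4u) permutes the nonzero elements of F,

      q sum nu^2 <= N^4 + q^(-d) sum_(u != 0) |g(u)|^2 <= N^4 + q^(3d+1) S,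

    and the right-hand side is N^4 (1 + M(q)) ([dist_energy_le],
    [Mq_exp_sum]).  Hence C = 1/2 works. *)

Import Order.TTheory GRing.Theory Num.Theory.
Set Implicit Arguments.
Unset Strict Implicit.
Unset Printing Implicit Defensive.

Local Open Scope ring_scope.

(** * Counting preliminaries *)

(** Cauchy-Schwarz against the constant 1, by summing the inequality
    2 a b <= a^2 + b^2 over all pairs. *)
Lemma sqr_sum_le (T : finType) (A : {set T}) (a : T -> nat) :
  ((\sum_(t in A) a t) ^ 2 <= #|A| * \sum_(t in A) a t ^ 2)%N.
Proof.
rewrite -(leq_pmul2l (isT : 0 < 2)%N).
have -> : (2 * (#|A| * \sum_(t in A) a t ^ 2) =
    \sum_(s in A) \sum_(t in A) (a s ^ 2 + a t ^ 2))%N.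
  transitivity (\sum_(s in A) (#|A| * a s ^ 2 + \sum_(t in A) a t ^ 2))%N.
    by rewrite big_split /= sum_nat_const -big_distrr /= mul2n addnn.
  by apply: eq_bigr => s _; rewrite big_split /= sum_nat_const.
rewrite -mulnn big_distrlr big_distrr /=.
apply: leq_sum => s _; rewrite big_distrr; apply: leq_sum => t _.
exact: nat_Cauchy.
Qed.

Lemma card_zmod_gt0 (V : finZmodType) : (0 < #|V|)%N.
Proof. by apply/card_gt0P; exists 0. Qed.

(** Translation by x permutes V but adds #|V| copies of x to the sum of all
    the elements of V. *)
Lemma mulrn_card_eq0 (V : finZmodType) (x : V) : x *+ #|V| = 0.
Proof.
apply: (addrI (\sum_y y)); rewrite addr0 -sumr_const -big_split /=.
by rewrite [RHS](reindex_inj (addIr x)).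
Qed.

Lemma odd_card_two_neq0 (F : finFieldType) : odd #|F| -> 2 != 0 :> F.
Proof.
move=> oddF; apply/eqP => two0.
have : #|F|%:R = 0 :> F by rewrite mulrn_card_eq0.
move/eqP; rewrite -[#|F|]odd_double_half oddF natrD -mul2n natrM two0 mul0r.
by rewrite addr0 oner_eq0.
Qed.

(** * The bilinear form and its quadratic form *)

Section Dot.
Variables (F : finFieldType) (d : nat).
Implicit Types (v w : 'rV[F]_d) (a : F).

Lemma dotvDr v w1 w2 : dotv v (w1 + w2) = dotv v w1 + dotv v w2.
Proof.
by rewrite -big_split /=; apply: eq_bigr => j _; rewrite mxE mulrDr.
Qed.

Lemma dotvC v w : dotv v w = dotv w v.
Proof. by apply: eq_bigr => j _; rewrite mulrC. Qed.

Lemma dotvNl v w : dotv (- v) w = - dotv v w.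
Proof. by rewrite /dotv -sumrN; apply: eq_bigr => j _; rewrite mxE mulNr. Qed.

Lemma dotvBl v1 v2 w : dotv (v1 - v2) w = dotv v1 w - dotv v2 w.
Proof. by rewrite dotvC dotvDr ![dotv w _]dotvC dotvNl. Qed.

Lemma dotvZr a v w : dotv v (a *: w) = a * dotv v w.
Proof. by rewrite /dotv mulr_sumr; apply: eq_bigr => j _; rewrite mxE mulrCA. Qed.

Lemma sqlenE v : sqlen v = dotv v v.
Proof. by apply: eq_bigr => j _; rewrite expr2. Qed.

Lemma sqlenD v w : sqlen (v + w) = sqlen v + 2 * dotv v w + sqlen w.
Proof. by rewrite !sqlenE dotvDr !(dotvC (v + w)) !dotvDr (dotvC w v); ring. Qed.

Lemma sqlenN v : sqlen (- v) = sqlen v.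
Proof. by apply: eq_bigr => j _; rewrite mxE sqrrN. Qed.

Lemma sqlenZ a v : sqlen (a *: v) = a ^+ 2 * sqlen v.
Proof. by rewrite !sqlenE dotvZr dotvC dotvZr mulrA expr2. Qed.

End Dot.

(** * Additive characters and orthogonality *)

Section Characters.
Variables (C : numClosedFieldType) (F : finFieldType) (chi : F -> C).
Hypothesis chi0 : chi 0 = 1.
Hypothesis chiD : forall x y, chi (x + y) = chi x * chi y.
Hypothesis chi_nontriv : exists x, chi x <> 1.

(** The values are roots of unity, since F is killed by its cardinality. *)
Lemma char_norm x : `|chi x| = 1.
Proof.
have chiX n : chi (x *+ n) = chi x ^+ n.
  by elim: n => [|n IHn]; rewrite ?chi0 // mulrS exprS chiD IHn.
have : chi x ^+ #|F| = 1.
  by rewrite -chiX mulrn_card_eq0.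
move=> /(congr1 Num.norm); rewrite normrX normr1 => /eqP.
by rewrite pexpr_eq1 ?card_zmod_gt0 // => /eqP.
Qed.

Lemma char_conj x : (chi x)^* = chi (- x).
Proof.
have nz : chi x != 0 by rewrite -normr_eq0 char_norm oner_eq0.
apply: (mulfI nz); rewrite -normCK char_norm expr1n.
by rewrite -chiD subrr chi0.
Qed.

(** Translating the summation variable by w0 multiplies the sum by
    psi w0 != 1. *)
Lemma sum_hom_eq0 (V : finZmodType) (psi : V -> C) (w0 : V) :
  (forall v w, psi (v + w) = psi v * psi w) -> psi w0 != 1 ->
  \sum_w psi w = 0.
Proof.
move=> psiD w0_neq1.
have : (psi w0 - 1) * \sum_w psi w = 0.
  rewrite mulrBl mul1r mulr_sumr [X in _ - X](reindex_inj (addrI w0)) /=.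
  by rewrite -sumrB big1 // => w _; rewrite psiD subrr.
by move/eqP; rewrite mulf_eq0 subr_eq0 (negPf w0_neq1) => /eqP.
Qed.

Lemma sum_char a : \sum_u chi (u * a) = if a == 0 then #|F|%:R else 0.
Proof.
case: eqP => [->|/eqP a_neq0].
  by under eq_bigr => u _ do rewrite mulr0 chi0; rewrite sumr_const.
have [t /eqP chit] := chi_nontriv.
apply: (@sum_hom_eq0 _ (fun u => chi (u * a)) (t / a)) => [v w|].
  by rewrite mulrDl chiD.
by rewrite divfK.
Qed.

Lemma sum_char_dotv d (v : 'rV[F]_d) :
  \sum_w chi (dotv v w) = if v == 0 then #|F|%:R ^+ d else 0.
Proof.
case: eqP => [->|/eqP v_neq0].
  rewrite (eq_bigr (fun=> 1)) => [|w _].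
    by rewrite sumr_const card_mx mul1n natrX.
  by rewrite /dotv big1 // => j _; rewrite mxE mul0r.
have [t /eqP chit] := chi_nontriv.
have [j vj] : exists j, v 0 j != 0.
  apply/existsP; apply: contraNT v_neq0; rewrite negb_exists => /forallP v0.
  by apply/eqP/rowP => j; rewrite mxE; apply/eqP/negPn/v0.
(* v . w takes the value t, where chi is not 1, at a multiple of the j-th
   basis vector *)
apply: (@sum_hom_eq0 _ (fun w => chi (dotv v w)) ((t / v 0 j) *: delta_mx 0 j)).
  by move=> w1 w2; rewrite dotvDr chiD.
rewrite dotvZr /dotv (bigD1 j) //= big1 => [|i i_neq].
  by rewrite !mxE !eqxx mulr1 addr0 divfK.
by rewrite mxE (negPf i_neq) andbF mulr0.
Qed.

(** Plancherel on F for the push-forward of the weight a under phi.  It is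
    used for phi = |x - y|^2 on pairs of points, with the indicator of E x E as
    the weight, and for phi = |m|^2 on frequencies, weighted by |e(m)|^2. *)
Lemma level_plancherel (T : finType) (phi : T -> F) (a : T -> C) :
  \sum_u `|\sum_p chi (u * phi p) * a p| ^+ 2 =
  #|F|%:R * \sum_(p : T * T | phi p.1 == phi p.2) a p.1 * (a p.2)^*.
Proof.
under eq_bigr => u _ do rewrite normCK rmorph_sum big_distrlr pair_big /=.
rewrite exchange_big mulr_sumr [RHS]big_mkcond /=; apply: eq_bigr => p _.
transitivity ((\sum_u chi (u * (phi p.1 - phi p.2))) * (a p.1 * (a p.2)^*)).
  rewrite mulr_suml; apply: eq_bigr => u _.
  by rewrite rmorphM /= char_conj mulrBr chiD; ring.
by rewrite sum_char subr_eq0; case: ifP; rewrite ?mul0r.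
Qed.

(** * Gauss sums and the duality of the distance sums *)

Section Gauss.
Variable d : nat.
Hypothesis two_neq0 : 2 != 0 :> F.
Implicit Types (u : F) (E : {set 'rV[F]_d}).

Let four_neq0 : 4 != 0 :> F.
Proof. by rewrite (natrM _ 2 2) mulf_neq0. Qed.

Definition gauss_sum u : C := \sum_(m : 'rV[F]_d) chi (u * sqlen m).

(** In |H(u)|^2 the difference of the two summation variables, v, is taken as
    a new variable; the phase is then linear in the other one, w, and
    orthogonality leaves only v = 0. *)
Lemma norm_gauss_sum u : u != 0 -> `|gauss_sum u| ^+ 2 = #|F|%:R ^+ d.
Proof.
move=> u_neq0; rewrite normCK /gauss_sum rmorph_sum mulrC big_distrlr /=.
transitivity (\sum_(w : 'rV[F]_d) \sum_v chi (u * sqlen v) * chi (dotv ((2 * u) *: v) w)).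
  apply: eq_bigr => w _; rewrite (reindex_inj (addIr w)) /=.
  apply: eq_bigr => v _; rewrite char_conj -!chiD sqlenD (dotvC (_ *: v)) dotvZr (dotvC w).
  by congr chi; ring.
rewrite exchange_big (bigD1 0) //= [X in _ + X]big1 => [|v v_neq0].
  rewrite -mulr_sumr sum_char_dotv scaler0 eqxx addr0 sqlenE.
  by rewrite /dotv big1 ?mulr0 ?chi0 ?mul1r // => j _; rewrite mxE mul0r.
by rewrite -mulr_sumr sum_char_dotv scaler_eq0 mulf_eq0 (negPf two_neq0)
  (negPf u_neq0) (negPf v_neq0) mulr0.
Qed.

(** The translation m = m' - v / (2u) removes the linear term. *)
Lemma complete_square u (v : 'rV[F]_d) : u != 0 ->
  \sum_m chi (u * sqlen m) * chi (dotv v m) =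
  chi (- (4 * u)^-1 * sqlen v) * gauss_sum u.
Proof.
move=> u_neq0; rewrite mulr_sumr.
rewrite (reindex_inj (addIr (- ((2 * u)^-1 *: v)))) /=.
apply: eq_bigr => m _; rewrite -!chiD; congr chi.
rewrite sqlenD sqlenN sqlenZ dotvDr -scaleNr !dotvZr -sqlenE (dotvC v m).
by field; rewrite u_neq0 two_neq0 four_neq0.
Qed.

Definition dist_sum E (s : F) : C :=
  \sum_(x in E) \sum_(y in E) chi (s * sqlen (x - y)).

(** The Fourier transform of E multiplied by q^d. *)
Definition exp_sum E (m : 'rV[F]_d) : C := \sum_(x in E) chi (- dotv x m).

Lemma norm_exp_sum E m :
  `|exp_sum E m| ^+ 2 = \sum_(x in E) \sum_(y in E) chi (dotv (y - x) m).
Proof.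
rewrite normCK /exp_sum rmorph_sum big_distrlr /=.
apply: eq_bigr => x _; apply: eq_bigr => y _.
by rewrite char_conj -chiD opprK dotvBl addrC.
Qed.

(** The heart of the argument: |e(m)|^2 is a sum of the characters
    chi ((y - x) . m) over x, y in E, and [complete_square] turns each of them,
    summed against chi (u |m|^2), into a phase in |x - y|^2. *)
Lemma dual_dist_sum E u : u != 0 ->
  \sum_m chi (u * sqlen m) * `|exp_sum E m| ^+ 2 =
  gauss_sum u * dist_sum E (- (4 * u)^-1).
Proof.
move=> u_neq0.
under eq_bigr => m _ do rewrite norm_exp_sum mulr_sumr.
rewrite exchange_big mulr_sumr; apply: eq_bigr => x _.
under eq_bigr => m _ do rewrite mulr_sumr.
rewrite exchange_big mulr_sumr; apply: eq_bigr => y _ /=.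
by rewrite complete_square // -sqlenN opprB mulrC.
Qed.

Definition dist_count E (t : F) : nat :=
  #|[set p in setX E E | sqlen (p.1 - p.2) == t]|.

Lemma sum_dist_sum E :
  \sum_s `|dist_sum E s| ^+ 2 = #|F|%:R * (\sum_t dist_count E t ^ 2)%:R.
Proof.
pose a (p : 'rV[F]_d * 'rV[F]_d) : C := (p \in setX E E)%:R.
transitivity (\sum_s `|\sum_p chi (s * sqlen (p.1 - p.2)) * a p| ^+ 2).
  apply: eq_bigr => s _; congr (`|_| ^+ 2); rewrite /dist_sum pair_big /=.
  rewrite big_mkcond /=; apply: eq_bigr => p _.
  by rewrite /a !inE; case: ifP; rewrite ?mulr1 ?mulr0.
rewrite (level_plancherel (fun p => sqlen (p.1 - p.2))); congr (_ * _).
(* quadruples with equal distances are sorted by the common distance t *)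
rewrite natr_sum (partition_big (fun p => sqlen (p.1.1 - p.1.2)) predT) //=.
apply: eq_bigr => t _; rewrite natrX expr2 /dist_count.
have -> : #|[set p in setX E E | sqlen (p.1 - p.2) == t]|%:R =
    \sum_(p | sqlen (p.1 - p.2) == t) a p.
  rewrite -sum1_card natr_sum [RHS]big_mkcond [LHS]big_mkcond /=.
  by apply: eq_bigr => p _; rewrite /a !inE; case: (_ == t); rewrite ?andbF ?andbT //; case: (_ && _).
rewrite big_distrlr pair_big /=.
apply: eq_big => [p | p _]; last by rewrite /a conjC_nat.
by rewrite andbC; case: eqP => //= ->; rewrite eq_sym.
Qed.

(** The term u = 0 of the dual sum, absent from the dual of the nonzero s, is
    nonnegative; adding it is the only loss. *)
Lemma dist_energy_le E :
  (#|F| * \sum_t dist_count E t ^ 2)%:R <=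
  #|E|%:R ^+ 4 + #|F|%:R / #|F|%:R ^+ d *
    \sum_(p : 'rV[F]_d * 'rV[F]_d | sqlen p.1 == sqlen p.2)
      `|exp_sum E p.1| ^+ 2 * `|exp_sum E p.2| ^+ 2 :> C.
Proof.
have q_neq0 : #|F|%:R != 0 :> C.
  by rewrite pnatr_eq0 -lt0n; exact: card_zmod_gt0.
rewrite natrM -sum_dist_sum (bigD1 0) //=.
have -> : dist_sum E 0 = #|E|%:R ^+ 2.
  rewrite /dist_sum.
  under eq_bigr => x _ do under eq_bigr => y _ do rewrite mul0r chi0.
  by rewrite !sumr_const -[LHS]mulr_natl expr2.
rewrite normrX normr_nat -exprM lerD2l.
(* the substitution s = h u pairs s with its dual frequency *)
pose h (u : F) := - (4 * u)^-1.
have hK : involutive h by move=> u; rewrite /h mulrN invrN opprK invfM invrK mulKf.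
have h_eq0 u : (h u == 0) = (u == 0).
  by rewrite /h oppr_eq0 invr_eq0 mulf_eq0 (negPf four_neq0).
rewrite (reindex_inj (inv_inj hK)) /=.
have -> : \sum_(u | h u != 0) `|dist_sum E (h u)| ^+ 2 =
    (#|F|%:R ^+ d)^-1 *
    \sum_(u | u != 0) `|\sum_m chi (u * sqlen m) * `|exp_sum E m| ^+ 2| ^+ 2.
  rewrite mulr_sumr; apply: eq_big => [u | u]; rewrite h_eq0 // => u_neq0.
  by rewrite dual_dist_sum // normrM exprMn norm_gauss_sum // mulKf ?expf_neq0.
rewrite [_ / _]mulrC -mulrA ler_pM2l ?invr_gt0 ?exprn_gt0 ?lt0r ?q_neq0 ?ler0n //.
have -> : \sum_(p : 'rV[F]_d * 'rV[F]_d | sqlen p.1 == sqlen p.2)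
      `|exp_sum E p.1| ^+ 2 * `|exp_sum E p.2| ^+ 2 =
   \sum_(p : 'rV[F]_d * 'rV[F]_d | sqlen p.1 == sqlen p.2)
      `|exp_sum E p.1| ^+ 2 * (`|exp_sum E p.2| ^+ 2)^*.
  by apply: eq_bigr => p _; rewrite rmorphXn /= conj_normC.
rewrite -(level_plancherel (@sqlen F d) (fun m => `|exp_sum E m| ^+ 2)).
by rewrite [leRHS](bigD1 0) //= lerDr exprn_ge0.
Qed.

End Gauss.
End Characters.

(** * From the energy to the number of distances *)

Lemma card_dist_energy (F : finFieldType) d (E : {set 'rV[F]_d}) :
  (#|E| ^ 4 <= #|distance_set E| * \sum_t dist_count E t ^ 2)%N.
Proof.
have -> : (#|E| ^ 4 = (\sum_(t in distance_set E) dist_count E t) ^ 2)%N.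
  rewrite (expnM _ 2 2) -[(#|E| ^ 2)%N]mulnn -cardsX -sum1_card; congr (_ ^ 2)%N.
  (* all N^2 pairs are counted by nu on the distance set *)
  rewrite (partition_big (fun p => sqlen (p.1 - p.2)) (mem (distance_set E))) /=.
    by apply: eq_bigr => t _; rewrite /dist_count -sum1dep_card.
  by move=> p; rewrite !inE => /andP[xE yE]; apply/imset2P; exists p.1 p.2.
apply: leq_trans (sqr_sum_le _ _) _; rewrite leq_mul2l; apply/orP; right.
by rewrite [leqRHS](bigID (mem (distance_set E))) leq_addr.
Qed.

Local Open Scope complex_scope.

Section Modulus.
Variables (R : realType) (F : finFieldType) (d : nat).
Variables (chi : F -> R[i]) (E : {set 'rV[F]_d}).

Lemma fourier_char_fun m :
  fourier chi (char_fun R E) m = (#|F|%:R ^+ d)^-1 * exp_sum chi E m.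
Proof.
rewrite /fourier /exp_sum [in RHS]big_mkcond; congr (_ * _).
by apply: eq_bigr => x _; rewrite /char_fun; case: ifP; rewrite ?mulr1 ?mulr0.
Qed.

Lemma real_complex_nat n : (n%:R : R)%:C = n%:R.
Proof. exact: (rmorph_nat (real_complex R)). Qed.

(** The normalization of M(q): each |E^|^2 is q^(-2d) |exp_sum|^2, so the factor
    q^(3d+1) becomes q^(1-d), and the real-valued modulus is moved to R[i],
    where the energy bound lives. *)
Lemma Mq_exp_sum : E != set0 ->
  (#|E|%:R ^+ 4 * Mq chi E)%:C =
  #|F|%:R / #|F|%:R ^+ d *
    \sum_(p : 'rV[F]_d * 'rV[F]_d | sqlen p.1 == sqlen p.2)
      `|exp_sum chi E p.1| ^+ 2 * `|exp_sum chi E p.2| ^+ 2.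
Proof.
move=> E_neq0.
have N_neq0 : #|E|%:R ^+ 4 != 0 :> R by rewrite expf_neq0 // pnatr_eq0 cards_eq0.
have q_neq0 : #|F|%:R != 0 :> R[i].
  by rewrite pnatr_eq0 -lt0n; exact: card_zmod_gt0.
rewrite /Mq mulrA mulrCA mulfV // mulr1 rmorphM rmorph_sum rmorphXn /= real_complex_nat !mulr_sumr.
apply: eq_bigr => p _.
have normE m : (ComplexField.Normc.normc (fourier chi (char_fun R E) m) ^+ 2)%:C =
   (#|F|%:R ^+ d)^-1 ^+ 2 * `|exp_sum chi E m| ^+ 2.
  rewrite rmorphXn /= -[(_ (_ m))%:C]/(`|fourier chi (char_fun R E) m|).
  by rewrite fourier_char_fun normrM exprMn normfV normrX normr_nat.
rewrite rmorphM /= !normE.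
rewrite exprD mulnC exprM expr1.
set Q := _ ^+ d.
have Q0 : Q != 0 by rewrite expf_neq0.
by field.
Qed.

End Modulus.

Theorem theorem1p3 (R : realType) (d : nat) (c : R)
    (hd : (2 <= d)%N) (hc : 0 < c) :
  exists2 C : R, 0 < C &
    forall (F : finFieldType) (chi : F -> R[i]) (E : {set 'rV[F]_d}),
      odd #|F| ->
      additive_character chi ->
      nontrivial_character chi ->
      c * #|F|%:R `^ (d%:R / 2) <= #|E|%:R ->
      C * Num.min #|F|%:R (#|F|%:R / Mq chi E) <= #|distance_set E|%:R.
Proof.
exists (2^-1); first by rewrite invr_gt0.
move=> F chi E oddF [chi0 chiD] chi_nontriv cE.
have q_gt0 : 0 < #|F|%:R :> R by rewrite ltr0n; exact: card_zmod_gt0.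
have E_neq0 : E != set0.
  rewrite -card_gt0 -(ltr0n R); apply: lt_le_trans cE.
  by rewrite mulr_gt0 // powR_gt0.
have N_gt0 : 0 < #|E|%:R ^+ 4 :> R by rewrite exprn_gt0 // ltr0n card_gt0.
have M_ge0 : 0 <= Mq chi E.
  rewrite /Mq mulr_ge0 // ?divr_ge0 ?exprn_ge0 ?ler0n //.
  by apply: sumr_ge0 => p _; rewrite -exprMn sqr_ge0.
(* multiply by N^4 and combine the energy bound with Cauchy-Schwarz *)
have main : #|F|%:R <= #|distance_set E|%:R * (1 + Mq chi E).
  have energy : (#|F| * \sum_t dist_count E t ^ 2)%:R <=
      #|E|%:R ^+ 4 + #|E|%:R ^+ 4 * Mq chi E.
    have := dist_energy_le chi0 chiD chi_nontriv (odd_card_two_neq0 oddF) E.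
    by rewrite -Mq_exp_sum // -!real_complex_nat -rmorphXn -rmorphD lecR.
  rewrite -(ler_pM2l N_gt0) mulrCA mulrDr mulr1.
  apply: le_trans (ler_wpM2l (ler0n _ _) energy).
  by rewrite -natrX -!natrM ler_nat mulnCA mulnC leq_mul2l card_dist_energy orbT.
rewrite mulrC ler_pdivrMr //.
rewrite ge_min; apply/orP.
have [M_le1 | M_gt1] := leP (Mq chi E) 1; [left | right].
  by apply: le_trans main _; rewrite ler_wpM2l ?ler0n //; lra.
rewrite ler_pdivrMr ?(lt_trans _ M_gt1) // -mulrA.
by apply: le_trans main _; rewrite ler_wpM2l ?ler0n //; lra.
Qed.
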